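(* Suppose that $X$ and $Y$ are compact Hausdorff spaces and $T:C(X)^{-1}\to C(Y)^{-1}$ is a surjective group homomorphism. If $$\sup_{f\in C(X)^{-1}}\frac{\|Tf\|_{\infty(Y)}}{\|f\|_{\infty(X)}}<\infty\quad\text{and}\quad \inf_{f\in C(X)^{-1}}\frac{\|Tf\|_{\infty(Y)}}{\|f\|_{\infty(X)}}>0,$$ then $C(X)$ is isometrically and algebraically isomorphic to $C(Y)$.
   Context: $C(X)$ is the Banach algebra of complex-valued continuous functions on $X$ with supremum norm $\|\cdot\|_{\infty(X)}$, and $C(X)^{-1}$ is the multiplicative group of its invertible elements. Group homomorphism means multiplicative map; no continuity is assumed. *)

(* Defs.v *)
From HB Require Import structures.
From mathcomp Require Import all_boot all_order all_algebra.
From mathcomp Require Import complex.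
From mathcomp Require Import all_classical all_reals all_analysis.

Set Implicit Arguments.
Unset Strict Implicit.
Unset Printing Implicit Defensive.

Import Order.TTheory GRing.Theory Num.Theory.
Import numFieldNormedType.Exports.
Import ComplexField.Normc.

Local Open Scope classical_set_scope.
Local Open Scope ring_scope.
Local Open Scope complex_scope.

(* The complex numbers are R[i]; the regular module R[i]^o is the alias of
   R[i] that carries the topology induced by the modulus. *)
Notation Cplx R := (R[i]^o).

Section ContinuousFunctions.
Context (R : realType) (X : topologicalType).

Definition cfun_pred : pred (X -> Cplx R) := fun f => `[< continuous f >].

Lemma cfun_subring_closed : subring_closed cfun_pred.
Proof.
split => [|f g /asboolP cf /asboolP cg|f g /asboolP cf /asboolP cg];
  apply/asboolP => x.
- exact: (@cvg_cst (Cplx R)).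
- by apply: (@cvgB _ (Cplx R)); [exact: cf|exact: cg].
- by apply: (@cvgM R[i]); [exact: cf|exact: cg].
Qed.

Lemma cfun_subsemimod_closed : subsemimod_closed cfun_pred.
Proof.
split; first exact: cfun_subring_closed.
move=> a f /asboolP cf; apply/asboolP => x.
by apply: (@cvgZr _ (Cplx R)); exact: cf.
Qed.

(* The algebra C(X).  It is the zero ring when X is empty, which is why it is
   given the structures of a (possibly zero) ring and of a module over R[i]
   rather than MathComp's algebra structures, which exclude the zero ring. *)
Definition cfun : Type := continuousType X (Cplx R).

HB.instance Definition _ := Choice.on cfun.

Definition cfun_val (f : cfun) : X -> Cplx R := f.
Definition cfun_Sub (f : X -> Cplx R) (cf : cfun_pred f) : cfun :=
  mkcts (asboolW cf).

Lemma cfun_Sub_rect (K : cfun -> Type) :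
  (forall f cf, K (@cfun_Sub f cf)) -> forall f, K f.
Proof.
move=> KSub f; have cf : cfun_pred (cfun_val f) by apply/asboolP; exact: cts_fun.
suff -> : f = cfun_Sub cf by exact: KSub.
exact/continuousEP.
Qed.

Lemma cfun_SubK (f : X -> Cplx R) cf : cfun_val (@cfun_Sub f cf) = f.
Proof. by []. Qed.

HB.instance Definition _ :=
  isSub.Build (X -> Cplx R) cfun_pred cfun cfun_Sub_rect cfun_SubK.
HB.instance Definition _ :=
  GRing.SubChoice_isSubComPzRing.Build (X -> Cplx R) cfun_pred cfun
    cfun_subring_closed.
HB.instance Definition _ :=
  GRing.SubZmodule_isSubLmodule.Build R[i] (X -> Cplx R) cfun_pred cfun
    cfun_subsemimod_closed.

(* The supremum is taken in R, where sup set0 = 0: if X is empty the norm is 0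
   and, as x / 0 = 0, so are the quotients of norms on the unit group. *)
Definition supnorm (f : cfun) : R := sup [set normc (f x) | x in [set: X]].

Definition cfun_inv : pred cfun := fun f => `[< exists g, f * g = 1 >].

Record cfun_unit : Type :=
  CfunUnit { cfun_unit_val :> cfun ; _ : cfun_inv cfun_unit_val }.

HB.instance Definition _ := [isSub for cfun_unit_val].
HB.instance Definition _ := [Choice of cfun_unit by <:].

Lemma cfun_inv1 : cfun_inv 1.
Proof. by apply/asboolP; exists 1; rewrite mulr1. Qed.

Lemma cfun_invM (f g : cfun_unit) : cfun_inv (val f * val g).
Proof.
case: f g => [f /= /asboolP[f' ff']] [g /= /asboolP[g' gg']].
by apply/asboolP; exists (f' * g'); rewrite mulrACA ff' gg' mulr1.
Qed.

Lemma cfun_unit_ex (f : cfun_unit) : exists g, val f * g = 1.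
Proof. by case: f => f /= /asboolP. Qed.

Lemma cfun_invV (f : cfun_unit) : cfun_inv (projT1 (cid (cfun_unit_ex f))).
Proof.
by case: cid => g /= fg; apply/asboolP; exists (val f); rewrite mulrC.
Qed.

Definition cfun_unit1 : cfun_unit := CfunUnit cfun_inv1.
Definition cfun_unitM (f g : cfun_unit) : cfun_unit := CfunUnit (cfun_invM f g).
(* cid is constructive indefinite description: it selects an inverse. *)
Definition cfun_unitV (f : cfun_unit) : cfun_unit := CfunUnit (cfun_invV f).

Fact cfun_unitMA : associative cfun_unitM.
Proof. by move=> f g h; apply: val_inj; exact: mulrA. Qed.
Fact cfun_unit1M : left_id cfun_unit1 cfun_unitM.
Proof. by move=> f; apply: val_inj; exact: mul1r. Qed.
Fact cfun_unitM1 : right_id cfun_unit1 cfun_unitM.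
Proof. by move=> f; apply: val_inj; exact: mulr1. Qed.
Fact cfun_unitMV : right_inverse cfun_unit1 cfun_unitV cfun_unitM.
Proof. by move=> f; apply: val_inj => /=; case: cid. Qed.
Fact cfun_unitVM : left_inverse cfun_unit1 cfun_unitV cfun_unitM.
Proof. by move=> f; rewrite -[RHS](cfun_unitMV f); apply: val_inj; exact: mulrC. Qed.

HB.instance Definition _ := isGroup.Build cfun_unit
  cfun_unitMA cfun_unit1M cfun_unitM1 cfun_unitVM cfun_unitMV.

End ContinuousFunctions.

Arguments cfun : clear implicits.
Arguments cfun_unit : clear implicits.

Definition isometrically_algebraically_isomorphic
    (R : realType) (X Y : topologicalType) : Prop :=
  exists Phi : cfun R X -> cfun R Y,
    [/\ linear Phi, monoid_morphism Phi, bijective Phi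
      & forall f, supnorm (Phi f) = supnorm f].

(* Main.v *)
Require Import Defs.
From HB Require Import structures.
From mathcomp Require Import all_boot all_order all_algebra.
From mathcomp Require Import complex.
From mathcomp Require Import all_classical all_reals all_analysis.

Import Order.TTheory GRing.Theory Num.Theory.
Import numFieldNormedType.Exports.

Local Open Scope classical_set_scope.
Local Open Scope ring_scope.

Import ComplexField.Normc.

(** Applying the two bounds to the powers of [f] and taking n-th roots removes
    the constants: [T] preserves the supremum norm ([supnorm_preserved]).  Since
    [|f| <= |g|] means that [f / g] has norm at most 1, the modulus of [T f]
    then depends only on the modulus of [f], and monotonically so ([logmod_le]).

    The moduli of invertible functions are exactly the functions [e^u] with [u]
    real and continuous, so [u |-> ln |T (e^u)|] is a map from the real
    continuous functions on [X] to those on [Y].  It is additive because [T] is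
    multiplicative, onto because [T] is, and it preserves suprema because [T]
    preserves the norm.  It follows that it is an order isomorphism fixing the
    constants, hence commutes with absolute values.  Such a map is a composition
    [u |-> u \o phi] ([composition_of_additive_bound_preserving]): for [y] in
    [Y], the nonnegative functions whose image vanishes at [y] cannot be bounded
    away from 0 and are stable under sums, so by compactness they have a common
    zero [phi y]; applied to [|u - c|], where [c] is the value at [y] of the
    image of [u], this gives [c = u (phi y)].

    The isomorphism is then [f |-> f \o phi] on complex functions.  Everything
    about it reduces to what is known of [u \o phi] for real [u]: continuity and
    surjectivity to the real and imaginary parts of [f], the norm equality to
    [u = |f|] ([composition_isomorphism]). *)

Set Implicit Arguments.
Unset Strict Implicit.
Unset Printing Implicit Defensive.

(** * Additive maps of real continuous functions that preserve bounds *)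

(** The sets [v < e] form a filter base, because [v + w < min d e] forces both
    [v < d] and [w < e]; a cluster point of the filter is a common zero. *)
Lemma compact_common_zero (R : realType) (X : topologicalType)
    (V : set (X -> R)) :
  compact [set: X] -> V !=set0 ->
  (forall v, V v -> continuous v /\ forall x, 0 <= v x) ->
  (forall v w, V v -> V w -> V (v \+ w)) ->
  (forall v e, V v -> 0 < e -> exists x, v x < e) ->
  exists x, forall v, V v -> v x = 0.
Proof.
move=> cptX [v0 Vv0] Vcge0 VD Vlt.
pose D : set ((X -> R) * R) := [set p | V p.1 /\ 0 < p.2].
pose B (p : (X -> R) * R) : set X := [set x | p.1 x < p.2].
have FF : ProperFilter (filter_from D B).
  apply: filter_from_proper; last by move=> [v e] /= [Vv e0]; exact: Vlt.
  apply: filter_from_filter; first by exists (v0, 1); split => /=.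
  move=> [v e] [w d] /= [/= Vv e0] [/= Vw d0].
  exists (v \+ w, Num.min e d).
    by split; [exact: VD|rewrite /= lt_min e0].
  move=> x; rewrite /B /= lt_min => /andP[ve wd].
  have [[_ /(_ x) v0x] [_ /(_ x) w0x]] := (Vcge0 _ Vv, Vcge0 _ Vw).
  split; first by rewrite (le_lt_trans _ ve)// lerDl.
  by rewrite (le_lt_trans _ wd)// lerDr.
have [x [_ clx]] : [set: X] `&` cluster (filter_from D B) !=set0.
  by apply: cptX; exists (v0, 1) => //; split => /=.
exists x => v Vv; have [cv vge0] := Vcge0 _ Vv.
apply/eqP; rewrite eq_le vge0 andbT leNgt; apply/negP => vx0.
have [z [/= zB]] : [set z | v z < v x / 2] `&` [set z | v x / 2 < v z] !=set0.
  apply: clx.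
    by exists (v, v x / 2) => //; split => //=; rewrite divr_gt0.
  apply: (cv x [set r | v x / 2 < r]); apply: lt_nbhsr.
  by rewrite ltr_pdivrMr// ltr_pMr// ltr1n.
by rewrite ltNge (ltW zB).
Qed.

(** A Banach-Stone theorem for additive maps: as [S] preserves upper bounds, it
    fixes constants, and additivity and surjectivity then turn it into an
    isomorphism of ordered groups, which must commute with absolute values.  So
    [S] maps [|u - c|] to [|S u - c|] for every constant [c], and a point [x]
    such that [v x = 0] whenever [v >= 0] and [S v y = 0] satisfies
    [u x = S u y] for all [u]. *)
Lemma composition_of_additive_bound_preserving (R : realType)
    (X Y : topologicalType) (S : (X -> R) -> (Y -> R)) :
  compact [set: X] ->
  (forall u, continuous u -> continuous (S u)) ->
  (forall u v, continuous u -> continuous v -> S (u \+ v) = S u \+ S v) ->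
  (forall u c, continuous u ->
     (forall x, u x <= c) <-> (forall y, S u y <= c)) ->
  (forall v, continuous v -> exists2 u, continuous u & S u = v) ->
  exists phi : Y -> X, forall u, continuous u -> S u = u \o phi.
Proof.
move=> cptX Scont SD Sle Ssurj.
have cN (u : X -> R) : continuous u -> continuous (\- u).
  by move=> cu x; apply: (@continuousN R R^o); exact: cu.
have cD (Z : topologicalType) (u v : Z -> R) :
    continuous u -> continuous v -> continuous (u \+ v).
  by move=> cu cv x; apply: (@continuousD R R^o); [exact: cu|exact: cv].
have cnorm (Z : topologicalType) (u : Z -> R) :
    continuous u -> continuous (fun z => `|u z|).
  by move=> cu x; apply: (@cvg_norm R R^o); exact: cu.
have ccst (c : R) : continuous (fun _ : X => c) by move=> x; exact: cvg_cst.
have S0 y : S (fun=> 0) y = 0.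
  have /(congr1 (@^~ y)) /= := SD _ _ (ccst 0) (ccst 0).
  have -> : (fun=> 0) \+ (fun=> 0) = (fun=> 0) :> (X -> R).
    by apply/funext => x /=; rewrite addr0.
  by move=> /esym/eqP; rewrite -subr_eq0 addrK => /eqP.
have SN u y : continuous u -> S (\- u) y = - S u y.
  move=> cu; have /(congr1 (@^~ y)) /= := SD _ _ cu (cN _ cu).
  have -> : u \+ \- u = fun=> 0 by apply/funext => x /=; rewrite subrr.
  by rewrite S0 => /esym/eqP; rewrite addrC addr_eq0 => /eqP.
have Sge u c : continuous u ->
    (forall x, c <= u x) <-> (forall y, c <= S u y).
  move=> cu; split => h.
    move=> y; rewrite -lerN2 -SN//; apply: (Sle _ _ (cN _ cu)).1 => x /=.
    by rewrite lerN2.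
  move=> x; rewrite -lerN2; apply: (Sle _ _ (cN _ cu)).2 => y.
  by rewrite SN// lerN2.
have Scst c y : S (fun=> c) y = c.
  apply/eqP; rewrite eq_le; apply/andP; split.
    exact: (Sle _ _ (ccst c)).1.
  exact: (Sge _ _ (ccst c)).1.
have Smono u v : continuous u -> continuous v ->
    (forall x, u x <= v x) <-> (forall y, S u y <= S v y).
  move=> cu cv; have cvu := cD _ _ _ cv (cN _ cu).
  have SB y : S (v \+ \- u) y = S v y - S u y.
    by rewrite (SD _ _ cv (cN _ cu)) /= SN.
  split => h.
    move=> y; rewrite -subr_ge0 -SB; apply: (Sge _ _ cvu).1 => x.
    by rewrite subr_ge0.
  move=> x; rewrite -subr_ge0; apply: (Sge _ _ cvu).2 => y.
  by rewrite SB subr_ge0.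
have Snorm u y : continuous u -> S (fun x => `|u x|) y = `|S u y|.
  move=> cu; have cu' := cnorm _ _ cu.
  apply/eqP; rewrite eq_le; apply/andP; split.
    (* The preimage [t] of [|S u|] dominates both [u] and [- u]. *)
    have [t ct St] := Ssurj _ (cnorm _ _ (Scont _ cu)).
    rewrite -[leRHS]/((fun y => `|S u y|) y) -St.
    apply: (Smono _ _ cu' ct).1 => x.
    rewrite ler_norml lerNl; apply/andP; split.
      apply: (Smono _ _ (cN _ cu) ct).2 => z.
      by rewrite SN// St -normrN ler_norm.
    by apply: (Smono _ _ cu ct).2 => z; rewrite St ler_norm.
  rewrite ler_norml lerNl -SN//; apply/andP; split.
    by apply: (Smono _ _ (cN _ cu) cu').1 => x; rewrite -normrN ler_norm.
  by apply: (Smono _ _ cu cu').1 => x; rewrite ler_norm.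
suff /choice[phi phiP] :
    forall y, exists x, forall u, continuous u -> S u y = u x.
  by exists phi => u cu; apply/funext => y; exact: phiP.
move=> y.
have [||||x xP] := @compact_common_zero R X
    [set v : X -> R | [/\ continuous v, forall x, 0 <= v x & S v y = 0]] cptX.
- by exists (fun=> 0); split.
- by move=> v [].
- move=> v w [cv v0 Sv] [cw w0 Sw]; split; first exact: cD.
    by move=> x; rewrite addr_ge0.
  by rewrite SD//= Sv Sw addr0.
- move=> v e [cv v0 Sv] e0; apply: contrapT => /forallNP h.
  have : e <= S v y.
    by apply: (Sge _ _ cv).1 => x; rewrite leNgt; apply/negP; exact: h.
  by rewrite Sv leNgt e0.
exists x => u cu.
have cuB := cD _ _ _ cu (ccst (- S u y)).
have := xP (fun x => `|u x - S u y|).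
have /[swap]/[apply] : [/\ continuous (fun x => `|u x - S u y|),
    forall x, 0 <= `|u x - S u y| & S (fun x => `|u x - S u y|) y = 0].
  split; [exact: cnorm cuB|by []|].
  by rewrite (Snorm _ _ cuB) (SD _ _ cu (ccst _)) /= Scst subrr normr0.
by move=> /normr0_eq0/eqP; rewrite subr_eq0 => /eqP.
Qed.

(** * Continuity of complex-valued functions *)

(** The radii of the balls of [R[i]] are complex; this turns them into reals. *)
Lemma gt0_complexE (R : realType) (e : R[i]) :
  0 < e -> e = (complex.Re e)%:C%C.
Proof. by case: e => a b; rewrite ltcE /= => /andP[/eqP -> _]. Qed.

Lemma norm_normc (R : realType) (z : R[i]) : `|z| = (normc z)%:C%C.
Proof. by case: z. Qed.

Lemma le_Re_normc (R : realType) (z : R[i]) : `|complex.Re z| <= normc z.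
Proof. by rewrite -lecR -norm_normc normc_ge_Re. Qed.

Lemma normc_gt0 (R : realType) (z : R[i]) : z != 0 -> 0 < normc z.
Proof. by move=> z0; rewrite -ltcR -norm_normc normr_gt0. Qed.

Lemma normc_nonneg (R : realType) (z : R[i]) : 0 <= normc z.
Proof. by rewrite -lecR -norm_normc normr_ge0. Qed.

Lemma normc_real (R : realType) (a : R) : normc (a%:C)%C = `|a|.
Proof.
apply: (@complexI R).
by rewrite -norm_normc normc_def /= expr0n addr0 sqrtr_sqr.
Qed.

Lemma normcX (R : realType) (z : R[i]) n : normc (z ^+ n) = normc z ^+ n.
Proof. by elim: n => [|n IHn]; rewrite ?normc1// !exprS normcM IHn. Qed.

Section ComplexContinuity.
Context (R : realType) (X : topologicalType).

Lemma continuous_Re (f : X -> Cplx R) :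
  continuous f -> continuous (fun x => complex.Re (f x)).
Proof.
move=> cf x; apply/(@cvgrPdist_lt R R^o) => e e0.
have /(@cvgrPdist_lt R[i] (Cplx R)) /(_ e%:C%C) := cf x.
rewrite ltcR => /(_ e0); apply: filterS => t.
rewrite norm_normc ltcR; apply: le_lt_trans.
by rewrite -raddfB le_Re_normc.
Qed.

Lemma continuous_real_complex (u : X -> R) :
  continuous u -> continuous (fun x => (u x)%:C%C : Cplx R).
Proof.
move=> cu x; apply/(@cvgrPdist_lt R[i] (Cplx R)) => e e0.
have e0' : 0 < complex.Re e by rewrite -ltcR -gt0_complexE.
have /(@cvgrPdist_lt R R^o) /(_ _ e0') := cu x.
apply: filterS => t.
by rewrite -rmorphB norm_normc (gt0_complexE e0) ltcR normc_real.
Qed.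

Lemma continuous_Im (f : X -> Cplx R) :
  continuous f -> continuous (fun x => complex.Im (f x)).
Proof.
move=> cf.
have -> : (fun x => complex.Im (f x)) =
    (fun x => complex.Re (- 'i%C * f x)).
  by apply/funext => x; case: (f x) => a b /=; simpc.
by apply: continuous_Re => x; apply: (@cvgM R[i]); [exact: cvg_cst|exact: cf].
Qed.

Lemma continuous_complex (f : X -> Cplx R) :
  continuous (fun x => complex.Re (f x)) ->
  continuous (fun x => complex.Im (f x)) -> continuous f.
Proof.
move=> cre cim; have -> : f = fun x =>
    ((complex.Re (f x))%:C + 'i * (complex.Im (f x))%:C)%C.
  by apply/funext => x; exact: complexE.
move=> x; apply: (@cvgD _ (Cplx R)); first exact: continuous_real_complex.
by apply: (@cvgM R[i]); [exact: cvg_cst|exact: continuous_real_complex].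
Qed.

Lemma continuous_normc (f : X -> Cplx R) :
  continuous f -> continuous (fun x => normc (f x)).
Proof.
move=> cf.
have -> : (fun x => normc (f x)) = (fun x => complex.Re (`|f x| : Cplx R)).
  by apply/funext => x; rewrite norm_normc.
by apply: continuous_Re => x; apply: (@cvg_norm R[i] (Cplx R)); exact: cf.
Qed.

End ComplexContinuity.

(** * The supremum norm *)

(** Evaluation as a function of its own, because products and powers in the
    group of invertible functions do not coerce to functions. *)
Definition at_pt (R : realType) (X : topologicalType) (f : cfun R X) (x : X) :
  R[i] := f x.

Section SupNorm.
Context (R : realType) (X : topologicalType).
Hypothesis cptX : compact [set: X].

Lemma cfun_continuous (f : cfun R X) : continuous (at_pt f : X -> Cplx R).
Proof. exact: cts_fun. Qed.

Lemma normc_le_supnorm (f : cfun R X) x : normc (at_pt f x) <= supnorm f.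
Proof.
apply: ub_le_sup; last by exists x.
have cpt : compact [set normc (at_pt f x) | x in [set: X]].
  apply: continuous_compact => //; apply: continuous_subspaceT.
  exact/continuous_normc/cfun_continuous.
by have [] : has_sup [set normc (at_pt f x) | x in [set: X]];
  first by apply: compact_has_sup => //; exists (normc (at_pt f x)), x.
Qed.

(** For [0 <= c] this also covers the empty space, where the norm is 0. *)
Lemma supnorm_leP (f : cfun R X) c : 0 <= c ->
  supnorm f <= c <-> forall x, normc (at_pt f x) <= c.
Proof.
move=> c0; split => [fc x|fc]; first exact: le_trans (normc_le_supnorm f x) fc.
have [[x _]|/nonemptyPn X0] := pselect ([set: X] !=set0).
  apply: ge_sup => [|_ [z _ <-]]; last exact: fc.
  by exists (normc (at_pt f x)), x.
by rewrite /supnorm X0 image_set0 sup0.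
Qed.

Lemma supnorm_ge0 (f : cfun R X) : 0 <= supnorm f.
Proof.
have [[x _]|/nonemptyPn X0] := pselect ([set: X] !=set0).
  exact: le_trans (normc_nonneg _) (normc_le_supnorm f x).
by rewrite /supnorm X0 image_set0 sup0.
Qed.

End SupNorm.

(** * Moduli of invertible functions *)

Definition cfun_of_continuous (R : realType) (X : topologicalType)
    (f : X -> Cplx R) (cf : continuous f) : cfun R X := cfun_Sub (asboolT cf).

Section Units.
Context (R : realType) (X : topologicalType).
Implicit Types f g : cfun_unit R X.

Lemma cfun_unitME f g x : at_pt (f * g)%g x = at_pt f x * at_pt g x.
Proof. by []. Qed.

Lemma cfun_unit1E x : at_pt (1%g : cfun_unit R X) x = 1.
Proof. by []. Qed.

Lemma cfun_unitXE f n x : at_pt (f ^+ n)%g x = at_pt f x ^+ n.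
Proof. by elim: n => [//|n IHn]; rewrite expgS exprS cfun_unitME IHn. Qed.

Lemma cfun_unit_normc_gt0 f x : 0 < normc (at_pt f x).
Proof.
apply: normc_gt0; apply/eqP => fx0.
have := cfun_unit1E x; rewrite -(mulgV f) cfun_unitME fx0 mul0r => /esym/eqP.
by rewrite oner_eq0.
Qed.

(** The inverse of [e^u] is [e^(-u)]. *)
Lemma ex_exp_unit (u : X -> R) : continuous u ->
  exists f : cfun_unit R X, forall x, at_pt f x = (expR (u x))%:C%C.
Proof.
move=> cu.
have ce (v : X -> R) : continuous v ->
    continuous (fun x => (expR (v x))%:C%C : Cplx R).
  move=> cv; apply: continuous_real_complex => x.
  apply: (@continuous_comp _ _ _ v expR); [exact: cv|exact: continuous_expR].
have cNu : continuous (\- u).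
  by move=> x; apply: (@continuousN R R^o); exact: cu.
have inv : cfun_inv (cfun_of_continuous (ce _ cu)).
  apply/asboolP; exists (cfun_of_continuous (ce _ cNu)).
  apply: val_inj; apply/funext => x /=.
  change ((expR (u x))%:C * (expR (- u x))%:C = 1 :> R[i])%C.
  by rewrite -rmorphM /= -expRD subrr expR0.
by exists (CfunUnit inv).
Qed.

(** [e^u] as an invertible function, and 1 if [u] is not continuous; being
    total, it does not carry a continuity proof. *)
Definition exp_unit (u : X -> R) : cfun_unit R X :=
  xget 1%g [set f : cfun_unit R X | forall x, at_pt f x = (expR (u x))%:C%C].

Lemma exp_unitE (u : X -> R) x : continuous u ->
  at_pt (exp_unit u) x = (expR (u x))%:C%C.
Proof.
move=> cu; have [f fE] := ex_exp_unit cu.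
rewrite /exp_unit; case: xgetP => [g -> gE|]; first exact: gE.
by move=> /(_ f)/(_ fE).
Qed.

Lemma normc_exp_unit (u : X -> R) x : continuous u ->
  normc (at_pt (exp_unit u) x) = expR (u x).
Proof. by move=> cu; rewrite exp_unitE// normc_real ger0_norm// expR_ge0. Qed.

Lemma cfun_unitP f g : (forall x, at_pt f x = at_pt g x) -> f = g.
Proof. by move=> fg; do 2! apply: val_inj; apply/funext => x; exact: fg. Qed.

Definition logmod f (x : X) : R := ln (normc (at_pt f x)).

Lemma continuous_logmod f : continuous (logmod f).
Proof.
move=> x.
apply: (@continuous_comp X R R (fun x => normc (at_pt f x)) (@ln R)).
  exact/continuous_normc/cfun_continuous.
exact/continuous_ln/cfun_unit_normc_gt0.
Qed.

Lemma logmodM f g : logmod (f * g)%g = logmod f \+ logmod g.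
Proof.
apply/funext => x.
by rewrite /logmod cfun_unitME normcM lnM// posrE cfun_unit_normc_gt0.
Qed.

Lemma logmod_exp_unit u : continuous u -> logmod (exp_unit u) = u.
Proof.
by move=> cu; apply/funext => x; rewrite /logmod normc_exp_unit// expRK.
Qed.

Lemma exp_unitD u v : continuous u -> continuous v ->
  exp_unit (u \+ v) = (exp_unit u * exp_unit v)%g.
Proof.
move=> cu cv.
have cuv : continuous (u \+ v).
  by move=> x; apply: (@continuousD R R^o); [exact: cu|exact: cv].
by apply: cfun_unitP => x; rewrite cfun_unitME !exp_unitE//= expRD rmorphM.
Qed.

Hypothesis cptX : compact [set: X].

Lemma supnorm_unit_leP f c :
  supnorm f <= expR c <-> forall x, logmod f x <= c.
Proof.
have fE x : (normc (at_pt f x) <= expR c) = (logmod f x <= c).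
  by rewrite -[in RHS](expRK c) ler_ln// posrE ?expR_gt0// cfun_unit_normc_gt0.
split.
  by move=> /(supnorm_leP cptX _ (expR_ge0 c)) h x; rewrite -fE; exact: h.
move=> h; apply/(supnorm_leP cptX _ (expR_ge0 c)) => x.
by have := h x; rewrite -fE.
Qed.

Lemma supnormX_le f n : supnorm (f ^+ n)%g <= supnorm f ^+ n.
Proof.
apply/(supnorm_leP cptX); first by rewrite exprn_ge0// supnorm_ge0.
move=> x.
rewrite cfun_unitXE normcX lerXn2r ?nnegrE ?supnorm_ge0 ?normc_nonneg//.
exact: normc_le_supnorm.
Qed.

End Units.

(** * Norms and powers *)

(** If [b < a], then [K * (b / a) ^+ n] tends to 0 and is at last below 1. *)
Lemma le_of_powers_le (R : realType) (K a b : R) : 0 <= a -> 0 <= b ->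
  (forall n, a ^+ n.+1 <= K * b ^+ n.+1) -> a <= b.
Proof.
move=> a0 b0 abK; rewrite leNgt; apply/negP => ba.
have apos : 0 < a := le_lt_trans b0 ba.
have rlt1 : `|b / a| < 1.
  by rewrite ger0_norm ?divr_ge0// ltr_pdivrMr// mul1r.
have /cvgrPdist_lt /(_ 1 ltr01) [n _ /(_ n.+1 (leqnSn n))] :=
  cvg_geometric K rlt1.
rewrite /geometric /= sub0r normrN => /(le_lt_trans (ler_norm _)).
by rewrite expr_div_n mulrA ltr_pdivrMr ?exprn_gt0// mul1r ltNge abK.
Qed.

Lemma supnorm_le_of_powers (R : realType) (X Y : topologicalType)
    (f : cfun_unit R X) (g : cfun_unit R Y) (K : R) :
  compact [set: X] -> compact [set: Y] -> 0 <= K ->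
  (forall n, supnorm (f ^+ n.+1)%g <= K * supnorm (g ^+ n.+1)%g) ->
  supnorm f <= supnorm g.
Proof.
move=> cptX cptY K0 fgK; apply/(supnorm_leP cptX); first exact: supnorm_ge0.
move=> x; apply: (@le_of_powers_le _ K);
  rewrite ?normc_nonneg ?supnorm_ge0// => n.
rewrite -normcX -cfun_unitXE.
apply: (le_trans (normc_le_supnorm cptX _ _)); apply: (le_trans (fgK n)).
by rewrite ler_wpM2l// supnormX_le.
Qed.

(** * Norm-preserving homomorphisms *)

Section NormPreserving.
Context (R : realType) (X Y : topologicalType).
Hypothesis cptX : compact [set: X].
Hypothesis cptY : compact [set: Y].
Variable T : {multiplicative cfun_unit R X -> cfun_unit R Y}.

Lemma gmulf_expgS f n : T (f ^+ n.+1)%g = (T f ^+ n.+1)%g.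
Proof. by elim: n => [//|n IHn]; rewrite expgS gmulfM IHn -expgS. Qed.

Lemma supnorm_preserved :
  (ereal_sup [set (supnorm (T f) / supnorm f)%:E
             | f in [set: cfun_unit R X]] < +oo)%E ->
  (0 < ereal_inf [set (supnorm (T f) / supnorm f)%:E
                 | f in [set: cfun_unit R X]])%E ->
  forall f, supnorm (T f) = supnorm f.
Proof.
set A := [set _ | _ in _] => supA infA.
have Asup f : ((supnorm (T f) / supnorm f)%:E <= ereal_sup A)%E.
  by apply: ereal_sup_ubound; exists f.
have Ainf f : (ereal_inf A <= (supnorm (T f) / supnorm f)%:E)%E.
  by apply: ereal_inf_lbound; exists f.
have [M MP] : exists M : R, forall f, supnorm (T f) / supnorm f <= M.
  case: (ereal_sup A) supA Asup => [M _ MP| //|_ /(_ 1%g)].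
    by exists M => f; rewrite -lee_fin.
  by rewrite leeNy_eq.
have [c c0 cP] :
    exists2 c : R, 0 < c & forall f, c <= supnorm (T f) / supnorm f.
  case: (ereal_inf A) infA Ainf => [c c0 cP|_ /(_ 1%g)|//].
    by exists c => // f; rewrite -lee_fin.
  by rewrite leye_eq.
(* If the norm of [f] were 0, as on the empty space, its quotient would be
   [x / 0 = 0], which is less than [c]. *)
have fpos (f : cfun_unit R X) : 0 < supnorm f.
  rewrite lt_def (supnorm_ge0 cptX) andbT; apply/eqP => f0.
  by have := lt_le_trans c0 (cP f); rewrite f0 invr0 mulr0 ltxx.
have M0 : 0 <= M by apply: le_trans (MP 1%g); rewrite divr_ge0 ?supnorm_ge0.
move=> f; apply/eqP; rewrite eq_le; apply/andP; split.
  apply: (@supnorm_le_of_powers _ _ _ _ _ M) => // n.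
  by rewrite -gmulf_expgS -ler_pdivrMr.
apply: (@supnorm_le_of_powers _ _ _ _ _ c^-1) => //.
  by rewrite invr_ge0 ltW.
by move=> n; rewrite -gmulf_expgS mulrC ler_pdivlMr// mulrC -ler_pdivlMr.
Qed.

Hypothesis Tnorm : forall f, supnorm (T f) = supnorm f.

(** [|f| <= |g|] says that [f / g] has norm at most 1, which [T] preserves. *)
Lemma logmod_le f g :
  (forall x, logmod f x <= logmod g x) ->
  forall y, logmod (T f) y <= logmod (T g) y.
Proof.
move=> fg y; pose h := (f * g^-1)%g.
have -> : f = (h * g)%g by rewrite -mulgA mulVg mulg1.
rewrite gmulfM logmodM /= gerDr; move: y.
rewrite -(supnorm_unit_leP cptY) Tnorm (supnorm_unit_leP cptX) => x.
by have := fg x; rewrite -{1}(divgK g f) -/h logmodM /= gerDr.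
Qed.

Definition logT (u : X -> R) : Y -> R := logmod (T (exp_unit u)).

(** [f] and [e^(ln |f|)] have the same modulus, hence so do their images. *)
Lemma logT_logmod f : logT (logmod f) = logmod (T f).
Proof.
have E : logmod (exp_unit (logmod f)) = logmod f.
  by rewrite logmod_exp_unit//; exact: continuous_logmod.
apply/funext => y; apply/eqP; rewrite eq_le.
by rewrite /logT !logmod_le// => x; rewrite E.
Qed.

(** Every bound [e^c] of a norm is positive, so preservation of norms is
    preservation of upper bounds after taking logarithms. *)
Lemma logT_le u c : continuous u ->
  (forall x, u x <= c) <-> (forall y, logT u y <= c).
Proof.
move=> cu; rewrite -(logmod_exp_unit cu) logT_logmod.
by rewrite -(supnorm_unit_leP cptX) -(supnorm_unit_leP cptY) Tnorm.
Qed.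

Hypothesis surjT : forall g, exists f, T f = g.

Lemma logT_composition :
  exists phi : Y -> X, forall u, continuous u -> logT u = u \o phi.
Proof.
apply: composition_of_additive_bound_preserving => //.
- by move=> u _; exact: continuous_logmod.
- by move=> u v cu cv; rewrite /logT exp_unitD// gmulfM logmodM.
- by move=> u c; exact: logT_le.
- move=> v cv; have [f fE] := surjT (exp_unit v).
  exists (logmod f); first exact: continuous_logmod.
  by rewrite logT_logmod fE logmod_exp_unit.
Qed.

End NormPreserving.

(** * From real functions to the complex algebra *)

(** The hypotheses say that composition with [phi] maps the real continuous
    functions on [X] onto those on [Y] without lowering suprema; injectivity on
    complex functions follows from the isometry. *)
Lemma composition_isomorphism (R : realType) (X Y : topologicalType)
    (phi : Y -> X) :
  compact [set: X] -> compact [set: Y] ->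
  (forall u : X -> R, continuous u -> continuous (u \o phi)) ->
  (forall (u : X -> R) c, continuous u ->
     (forall y, u (phi y) <= c) -> forall x, u x <= c) ->
  (forall v : Y -> R, continuous v ->
     exists2 u : X -> R, continuous u & v = u \o phi) ->
  isometrically_algebraically_isomorphic R X Y.
Proof.
move=> cptX cptY phic phile phisurj.
have cphi (f : cfun R X) : continuous (at_pt f \o phi : Y -> Cplx R).
  apply: continuous_complex.
    exact: (phic _ (continuous_Re (@cfun_continuous _ _ f))).
  exact: (phic _ (continuous_Im (@cfun_continuous _ _ f))).
pose Phi (f : cfun R X) : cfun R Y := cfun_of_continuous (cphi f).
have PhiE f y : at_pt (Phi f) y = at_pt f (phi y) by [].
have normPhi f : supnorm (Phi f) = supnorm f.
  apply/eqP; rewrite eq_le; apply/andP; split; apply/supnorm_leP => //;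
    rewrite ?supnorm_ge0//.
    by move=> y; rewrite PhiE normc_le_supnorm.
  apply: phile; first exact/continuous_normc/cfun_continuous.
  by move=> y; rewrite -PhiE normc_le_supnorm.
have linPhi : linear Phi by move=> a f g; apply: val_inj; apply/funext.
exists Phi; split => //.
- split; last by move=> f g; apply: val_inj; apply/funext.
  by apply: val_inj; apply/funext.
- have PhiB f g : Phi (f - g) = Phi f - Phi g by apply: val_inj; apply/funext.
  have injPhi : injective Phi.
    move=> f g fg; apply: val_inj; apply/funext => x.
    have := normc_le_supnorm cptX (f - g) x.
    rewrite -normPhi PhiB fg subrr.
    have -> : supnorm (0 : cfun R Y) = 0.
      apply/eqP; rewrite eq_le supnorm_ge0// andbT.
      by apply/supnorm_leP => // y; rewrite -[at_pt _ _]/0 normc0.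
    rewrite le_eqVlt ltNge normc_nonneg orbF => /eqP /eq0_normc /eqP.
    by rewrite -[at_pt _ _]/(f x - g x) subr_eq0 => /eqP.
  have surjPhi g : exists f, Phi f = g.
    have [u cu uE] := phisurj _ (continuous_Re (@cfun_continuous _ _ g)).
    have [v cv vE] := phisurj _ (continuous_Im (@cfun_continuous _ _ g)).
    have cf : continuous (fun x => (u x +i* v x)%C : Cplx R).
      exact: continuous_complex.
    exists (cfun_of_continuous cf); apply: val_inj; apply/funext => y.
    rewrite -[RHS]/(at_pt g y) -[LHS]/((u (phi y) +i* v (phi y))%C).
    rewrite -[u _]/((u \o phi) y) -[v _]/((v \o phi) y) -uE -vE.
    by case: (at_pt g y).
  have [Psi PsiP] := choice surjPhi.
  by exists Psi => // f; apply: injPhi; rewrite PsiP.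
Qed.

Theorem corollary3p4 (R : realType) (X Y : topologicalType)
    (compactX : compact [set: X]) (hausdorffX : hausdorff_space X)
    (compactY : compact [set: Y]) (hausdorffY : hausdorff_space Y)
    (T : {multiplicative cfun_unit R X -> cfun_unit R Y})
    (surjT : forall g : cfun_unit R Y, exists f : cfun_unit R X, T f = g)
    (supT : (ereal_sup [set (supnorm (T f) / supnorm f)%:E
                       | f in [set: cfun_unit R X]] < +oo)%E)
    (infT : (0 < ereal_inf [set (supnorm (T f) / supnorm f)%:E
                           | f in [set: cfun_unit R X]])%E) :
  isometrically_algebraically_isomorphic R X Y.
Proof.
have Tnorm := supnorm_preserved compactX compactY supT infT.
have [phi phiE] := logT_composition compactX compactY Tnorm surjT.
apply: (@composition_isomorphism _ _ _ phi) => //.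
- by move=> u cu; rewrite -phiE//; exact: continuous_logmod.
- move=> u c cu; rewrite (logT_le compactX compactY Tnorm _ cu) phiE//; exact.
- move=> v cv; have [f fE] := surjT (exp_unit v).
  exists (logmod f); first exact: continuous_logmod.
  rewrite -phiE; last exact: continuous_logmod.
  by rewrite (logT_logmod compactX compactY Tnorm) fE logmod_exp_unit.
Qed.
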